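(* Let $\mathcal{C}$ be a proper permutation class. Then there exists a permutation class $\mathcal{D}$ with $\mathcal{C}\subseteq\mathcal{D}$ such that the generating function $\sum_{n\ge 1}|\mathcal{D}_n|x^n$ is rational, where $\mathcal{D}_n$ denotes the set of permutations of length $n$ in $\mathcal{D}$.
   Context: A permutation of length $n$ is a bijection $\pi$ of $\{1,\dots,n\}$, written as the sequence $\pi(1)\pi(2)\cdots\pi(n)$. A permutation $\pi$ of length $n$ contains a permutation $\sigma$ of length $k$, written $\sigma\le\pi$, if $\pi$ has a (not necessarily contiguous) subsequence of length $k$ whose entries are in the same relative order as those of $\sigma$. A permutation class is a set $\mathcal{C}$ of permutations that is downward closed: if $\pi\in\mathcal{C}$ and $\sigma\le\pi$ then $\sigma\in\mathcal{C}$. A permutation class is proper if it omits at least one permutation. A generating function is rational if it is the power series expansion of a quotient of two polynomials in $x$. *)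

(* Defs.v *)
From HB Require Import structures.
From mathcomp Require Import all_boot all_order all_algebra all_fingroup.

Set Implicit Arguments.
Unset Strict Implicit.
Unset Printing Implicit Defensive.

Import GRing.Theory.
Local Open Scope ring_scope.

(* A permutation of length n is an element of 'S_n; positions and values are
   0-based, which does not affect relative order. *)
Definition contained (k n : nat) (s : 'S_k) (p : 'S_n) : Prop :=
  exists f : 'I_k -> 'I_n,
    (forall i j : 'I_k, (i < j)%N -> (f i < f j)%N) /\
    (forall i j : 'I_k, (s i < s j)%N = (p (f i) < p (f j))%N).

(* A set of permutations, given by its members of each length. *)
Definition permset : Type := forall n : nat, {set 'S_n}.

Definition permset_sub (C D : permset) : Prop :=
  forall n : nat, C n \subset D n.

Definition perm_class (C : permset) : Prop :=
  forall (k n : nat) (s : 'S_k) (p : 'S_n),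
    p \in C n -> contained s p -> s \in C k.

Definition proper_permset (C : permset) : Prop :=
  exists (n : nat) (s : 'S_n), s \notin C n.

(* Formal power series are represented by their coefficient sequences. *)
Definition series_mul (R : pzRingType) (a b : nat -> R) : nat -> R :=
  fun n => \sum_(i < n.+1) a i * b (n - i)%N.

(* As q`_0 != 0, q is invertible as a power series, so the equation
   q * a = p says exactly that a is the expansion of p / q. A quotient of
   polynomials that has a power series expansion can, after cancelling common
   factors, be written with such a denominator. *)
Definition rational_series (F : fieldType) (a : nat -> F) : Prop :=
  exists p q : {poly F},
    q`_0 != 0 /\ forall n : nat, series_mul (fun i => q`_i) a n = p`_n.

(* The sum starts at n = 1, so the constant term is 0. *)
Definition class_gf (C : permset) : nat -> rat :=
  fun n => if n == 0%N then 0 else #|C n|%:R.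

(* Main.v *)
Require Import Defs.
From mathcomp Require Import all_boot all_order all_algebra all_fingroup.
From mathcomp Require Import zify.

Set Implicit Arguments.
Unset Strict Implicit.
Unset Printing Implicit Defensive.

Import GRing.Theory.

(** Suppose that [X] is a class whose counting sequence is rational, that
    [|C_n| <= K ^ n], and that [X] has a set [A] of minimal non-members with at
    least [2 * K ^ n] of them of each large length [n]. Adding minimal
    non-members to [X] leaves it downward closed, so one may take for [D] the
    union of [X], [C] and a subset [S] of [A \ C], where [S_n] has exactly
    [K ^ n - |C_n \ X_n|] elements for large [n]. Then [|D_n| = |X_n| + K ^ n]
    for all but finitely many [n], whatever [C] looks like, and this is
    rational.

    The bound [|C_n| <= K ^ n] is the Stanley-Wilf conjecture
    ([stanley_wilf]), obtained from the Marcus-Tardos theorem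
    ([marcus_tardos]) by Klazar's argument ([card_avoiders]).

    For [X], read a permutation from left to right and let its height at a cut
    be the number of entries still to come that lie below the maximum read so
    far. Each step of the height is a function of the Lehmer code letter
    ([height_step]): a new maximum sets the height to the letter, any other
    entry lowers it by one. The class [X] (see [plateau_free]) consists of the
    permutations of height at most [P] that do not have two cuts of height [P]
    with all heights between them at least [F]. When a permutation is contained
    in another, every cut of the large one is sent to a cut of the small one
    that is not higher ([height_pull]), so long plateaus lift and [X] is a
    class. Whether a permutation is in [X] is decided by a finite automaton
    reading its Lehmer code, so [X] is counted by powers of a transfer matrix
    ([card_accept_letters]), and the Cayley-Hamilton theorem gives a rational
    generating function ([rational_of_transfer_matrix]).

    A minimal non-member must have a plateau that the deletion of any entry
    destroys. To get one, start with a jump to height [P], fall to [F],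
    alternate jumps from [F] to [F + 1] with falls back to [F], jump from [F] to
    [P], and fall to [0]. If every falling entry in the middle was already
    pending before the jump that precedes it, which is a condition [c + 1 < F]
    on its letter [c], each deletion lowers a height [F] or [P]
    ([plateau_word_minimal]). This leaves [F - 1] choices for every two letters,
    so the number of these permutations grows as fast as desired
    ([large_antichain]). *)

(** * Counting and increasing maps *)

Lemma card_ord_lt (N m : nat) : m <= N -> #|[set c : 'I_N | c < m]| = m.
Proof.
move=> mN; rewrite -sum1dep_card (big_ord_narrow mN) /=.
by rewrite -[RHS]card_ord -sum1_card.
Qed.

Lemma card_le_fibers (aT rT : finType) (f : aT -> rT) (S : {set aT})
    (R : {set rT}) (m : nat) :
  (forall x, x \in S -> f x \in R) ->
  (forall y, y \in R -> #|[set x in S | f x == y]| <= m) ->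
  #|S| <= #|R| * m.
Proof.
move=> fSR fib.
rewrite -sum1_card (partition_big f (mem R)) //=.
rewrite -sum_nat_const; apply: leq_sum => y yR.
apply: leq_trans (fib y yR); rewrite -sum1_card.
by rewrite leq_eqVlt; apply/orP; left; apply/eqP; apply: eq_bigl => x; rewrite !inE.
Qed.

Definition increasing (k n : nat) (f : 'I_k -> 'I_n) : Prop :=
  forall i j : 'I_k, i < j -> f i < f j.

Lemma increasing_mono (k n : nat) (f : 'I_k -> 'I_n) (i j : 'I_k) :
  increasing f -> (f i < f j) = (i < j).
Proof.
move=> fi; case: (ltngtP i j) => [/fi -> //|/fi/ltnW|/val_inj ->]; last by rewrite ltnn.
by rewrite leqNgt => /negbTE.
Qed.

Lemma increasing_inj (k n : nat) (f : 'I_k -> 'I_n) : increasing f -> injective f.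
Proof.
move=> fi i j fij; apply: val_inj => /=.
by move: (increasing_mono i j fi) (increasing_mono j i fi); rewrite fij ltnn; lia.
Qed.

(** The enumeration of a set of ordinals is increasing, so its first [k] terms
    give the map. *)
Lemma increasing_enum (N k : nat) (S : {set 'I_N}) :
  k <= #|S| -> exists2 e : 'I_k -> 'I_N, increasing e & forall i, e i \in S.
Proof.
move=> kS; case: (posnP k) => [k0|k_gt0].
  move: kS; rewrite {}k0 => _.
  by exists (fun i : 'I_0 => match notF (ltn_ord i) with end) => [] [].
have /card_gt0P[x0 _] : 0 < #|S| by apply: leq_trans kS.
have srt : sorted ltn (map val (enum S)).
  apply: (@subseq_sorted _ ltn ltn_trans _ (map val (enum 'I_N))).
    by apply: map_subseq; rewrite {1}/enum_mem -enumT filter_subseq.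
  by rewrite val_enum_ord iota_ltn_sorted.
exists (fun i : 'I_k => nth x0 (enum S) i) => [i j ij|i]; last first.
  by rewrite -mem_enum mem_nth // -cardE (leq_trans (ltn_ord i) kS).
have szi (l : 'I_k) : l < size (enum S) by rewrite -cardE (leq_trans (ltn_ord l) kS).
have := sorted_ltn_nth ltn_trans (val x0) srt.
move/(_ i j); rewrite !inE !size_map !szi => /(_ isT isT ij).
by rewrite !(nth_map x0) ?szi.
Qed.

(** * The Marcus-Tardos theorem and the Stanley-Wilf bound *)

Section MarcusTardos.
Variables (k : nat).

Section Fixed.
Variables (N : nat).
Implicit Types (s : 'S_k) (A B : {set 'I_N * 'I_N}).

Definition mx_contains s A : bool :=
  [exists f : {ffun 'I_k -> 'I_N}, [exists g : {ffun 'I_k -> 'I_N},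
    [&& [forall i : 'I_k, forall j : 'I_k, (i < j) ==> (f i < f j)],
        [forall i : 'I_k, forall j : 'I_k, (i < j) ==> (g i < g j)]
      & [forall i : 'I_k, (f i, g (s i)) \in A]]]].

Lemma mx_containsP s A :
  reflect (exists f g : 'I_k -> 'I_N,
    [/\ increasing f, increasing g & forall i, (f i, g (s i)) \in A])
  (mx_contains s A).
Proof.
apply: (iffP existsP) => [[f /existsP[g /and3P[fi gi fg]]]|[f [g [fi gi fg]]]].
  exists f, g; split.
  - by move=> i j ij; move/forallP: fi => /(_ i)/forallP/(_ j)/implyP; apply.
  - by move=> i j ij; move/forallP: gi => /(_ i)/forallP/(_ j)/implyP; apply.
  - by move=> i; move/forallP: fg.
exists [ffun i => f i]; apply/existsP; exists [ffun i => g i]; apply/and3P; split.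
- by apply/forallP=> i; apply/forallP=> j; rewrite !ffunE; apply/implyP/fi.
- by apply/forallP=> i; apply/forallP=> j; rewrite !ffunE; apply/implyP/gi.
- by apply/forallP=> i; rewrite !ffunE.
Qed.

Definition transpose A : {set 'I_N * 'I_N} := [set (x.2, x.1) | x in A].

Lemma mem_transpose A x y : ((x, y) \in transpose A) = ((y, x) \in A).
Proof.
apply/imsetP/idP => [[[a b] ab [-> ->]] //|yx].
by exists (y, x).
Qed.

Lemma mx_contains_transpose s A :
  mx_contains s^-1 (transpose A) = mx_contains s A.
Proof.
apply/mx_containsP/mx_containsP => -[f [g [fi gi fg]]]; exists g, f; split=> // i.
  by have := fg (s i); rewrite mem_transpose permK.
by have := fg (s^-1%g i); rewrite mem_transpose permKV.
Qed.

(** A set of pairs stands for a 0-1 matrix. All matrices live in the same type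
    [{set 'I_N * 'I_N}], their size being recorded by inclusion in a square,
    so that contracting a matrix does not change its type. *)
Definition square (m : nat) : {set 'I_N * 'I_N} :=
  [set x : 'I_N * 'I_N | (x.1 < m) && (x.2 < m)].

Variables (b : nat).
Hypothesis (b_gt0 : 0 < b).

Lemma block_proof (x : 'I_N) : x %/ b < N.
Proof. exact: leq_ltn_trans (leq_div _ _) (ltn_ord x). Qed.

Definition block_of (x : 'I_N) : 'I_N := Ordinal (block_proof x).
Definition block_of2 (x : 'I_N * 'I_N) := (block_of x.1, block_of x.2).
Definition contraction A := block_of2 @: A.
Definition block A c := [set x in A | block_of2 x == c].
Definition interval c : {set 'I_N} := [set y | block_of y == c].

Lemma block_of_lt (x y : 'I_N) : block_of x < block_of y -> x < y.
Proof.
move=> /= lt_xy; rewrite ltnNge; apply/negP => le_yx.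
by move: lt_xy; rewrite ltnNge leq_div2r.
Qed.

Lemma card_interval c : #|interval c| <= b.
Proof.
have lt_b (y : 'I_N) : y %% b < b by rewrite ltn_mod.
pose f y : 'I_b := Ordinal (lt_b y).
rewrite -(card_in_imset (f := f)) => [|x y]; last first.
  rewrite !inE => /eqP xc /eqP yc [xy]; apply: val_inj => /=.
  rewrite (divn_eq x b) (divn_eq y b) xy.
  by have /(congr1 val)/= -> : block_of x = block_of y by rewrite xc yc.
by rewrite -[X in _ <= X]card_ord max_card.
Qed.

Lemma card_block A c : #|block A c| <= b ^ 2.
Proof.
apply: (@leq_trans #|setX (interval c.1) (interval c.2)|).
  apply/subset_leq_card/subsetP => -[x y]; rewrite !inE => /andP[_ /eqP <- /=].
  by rewrite !eqxx.
by rewrite cardsX leq_mul ?card_interval.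
Qed.

(** Entries of different blocks compare as their blocks do, and an occurrence of
    a permutation uses each row and each column only once. *)
Lemma contraction_contains s A :
  mx_contains s (contraction A) -> mx_contains s A.
Proof.
move=> /mx_containsP[f [g [fi gi fg]]]; apply/mx_containsP.
have {}fg i : exists x, (x \in A) && (block_of2 x == (f i, g (s i))).
  by have /imsetP[x xA ->] := fg i; exists x; rewrite xA eqxx.
pose x i := xchoose (fg i).
have xP i : (x i \in A) /\ block_of2 (x i) = (f i, g (s i)).
  by have /andP[? /eqP] := xchooseP (fg i).
have x1 i : block_of (x i).1 = f i by case: (xP i) => _ [].
have x2 i : block_of (x i).2 = g (s i) by case: (xP i) => _ [].
exists (fun i => (x i).1), (fun i => (x (s^-1%g i)).2); split.
- by move=> i j ij; apply: block_of_lt; rewrite !x1; apply: fi.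
- by move=> i j ij; apply: block_of_lt; rewrite !x2 !permKV; apply: gi.
- by move=> i; rewrite permK -surjective_pairing; case: (xP i).
Qed.

Definition columns A c : {set 'I_N} := snd @: block A c.
Definition rows A c : {set 'I_N} := fst @: block A c.

Lemma columns_sub A c : columns A c \subset interval c.2.
Proof.
apply/subsetP => y /imsetP[x]; rewrite inE => /andP[_ /eqP <-] -> /=.
by rewrite inE.
Qed.

(** Take [k] blocks of one column of blocks whose nonzero columns form the same
    set [Y], of size at least [k]. Any permutation of length [k] occurs in their
    union: choose the column of the [i]-th entry in [Y] and the entry itself in
    the [i]-th of these blocks. *)
Lemma few_equal_columns s A c2 (Y : {set 'I_N}) : ~~ mx_contains s A -> k <= #|Y| ->
  #|[set c1 | columns A (c1, c2) == Y]| <= k.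
Proof.
move=> avoid kY; rewrite leqNgt; apply: contra avoid => /ltnW.
move=> /increasing_enum[f fi fS]; have [g gi gY] := increasing_enum kY.
have {fS} fS i : exists x, [&& x \in A, block_of x.1 == f i & x.2 == g (s i)].
  have := gY (s i); have := fS i; rewrite inE => /eqP <- /imsetP[x].
  by rewrite inE => /andP[xA /eqP[<- _]] ->; exists x; rewrite xA !eqxx.
pose x i := xchoose (fS i).
have xP i : [/\ x i \in A, block_of (x i).1 = f i & (x i).2 = g (s i)].
  by have /and3P[? /eqP ? /eqP ?] := xchooseP (fS i).
apply/mx_containsP; exists (fun i => (x i).1), g; split=> // [i j ij|i].
  apply: block_of_lt; case: (xP i) => _ -> _; case: (xP j) => _ -> _; exact: fi.
by case: (xP i) => ? _ <-; rewrite -surjective_pairing.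
Qed.

(** Pigeonhole on the set of nonzero columns of a block, which has at most
    [2 ^ b] values within a column of blocks. *)
Lemma few_wide_blocks s A m : ~~ mx_contains s A ->
  #|[set c in square m | k <= #|columns A c|]| <= m * (2 ^ b * k).
Proof.
move=> avoid.
pose I := [set c : 'I_N | c < m].
have cardI : #|I| <= m.
  case: (leqP m N) => [/card_ord_lt-> // |/ltnW]; apply: leq_trans.
  by rewrite -[X in _ <= X]card_ord max_card.
apply: (@leq_trans (#|I| * (2 ^ b * k))); last by rewrite leq_mul2r cardI orbT.
apply: (card_le_fibers (f := snd)) => [c|c2 _].
  by rewrite !inE => /andP[/andP[]].
apply: (@leq_trans (#|powerset (interval c2)| * k)); last first.
  by rewrite leq_mul2r card_powerset leq_exp2l // card_interval orbT.
apply: (card_le_fibers (f := columns A)) => [c|Y].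
  by rewrite !inE => /andP[_ /eqP <-]; apply: columns_sub.
rewrite inE => _; case: (leqP k #|Y|) => [kY|Yk].
  apply: leq_trans (few_equal_columns c2 avoid kY).
  rewrite -[X in _ <= X](card_imset _ (_ : injective (fun c1 => (c1, c2)))).
    apply/subset_leq_card/subsetP => -[c1 c2']; rewrite !inE /=.
    move=> /andP[/andP[_ /eqP ->] cY].
    by apply/imsetP; exists c1; rewrite ?inE.
  by move=> ? ? [].
rewrite (_ : [set _ in _ | _] = set0) ?cards0 //; apply/setP => c; rewrite !inE.
by apply/negP => /andP[/andP[/andP[_ kc] _] /eqP cY]; move: Yk; rewrite -cY ltnNge kc.
Qed.

Lemma few_tall_blocks s A m : ~~ mx_contains s A ->
  #|[set c in square m | k <= #|rows A c|]| <= m * (2 ^ b * k).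
Proof.
rewrite -mx_contains_transpose => /few_wide_blocks-/(_ m); apply: leq_trans.
rewrite -(card_imset _ (can_inj swap_pairK)).
apply/subset_leq_card/subsetP => _ /imsetP[[c1 c2] + ->].
rewrite !inE /= => /andP[/andP[-> ->]] /leq_trans-> //.
apply/subset_leq_card/subsetP => _ /imsetP[[x y] + ->].
rewrite inE => /andP[xy /eqP[xc yc]]; apply/imsetP; exists (y, x) => //.
by rewrite inE mem_transpose xy /block_of2 /= xc yc eqxx.
Qed.

Lemma card_block_rows_columns A c : #|block A c| <= #|rows A c| * #|columns A c|.
Proof.
rewrite -cardsX; apply/subset_leq_card/subsetP => x xB.
by rewrite inE !imset_f.
Qed.

Lemma contraction_square A m : A \subset square (b * m) ->
  contraction A \subset square m.
Proof.
move=> sA; apply/subsetP => _ /imsetP[x /(subsetP sA) + ->].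
by rewrite !inE /= !ltn_divLR // mulnC.
Qed.

(** The Marcus-Tardos recurrence: a block with fewer than [k] nonzero rows and
    columns has at most [k ^ 2] entries, and the other blocks are few. *)
Lemma card_avoid_contraction s A m :
  A \subset square (b * m) -> ~~ mx_contains s A ->
  #|A| <= #|contraction A| * k ^ 2 + 2 ^ b * k * b ^ 2 * 2 * m.
Proof.
move=> sA avoid.
pose part (R : {set 'I_N * 'I_N}) := [set x in A | block_of2 x \in R].
have partE (R : {set 'I_N * 'I_N}) c : c \in R ->
    [set x in part R | block_of2 x == c] = block A c.
  by move=> cR; apply/setP => x; rewrite !inE; case: eqP => [->|]; rewrite ?cR ?andbT ?andbF.
have card_part (R : {set 'I_N * 'I_N}) u :
    (forall c, c \in R -> #|block A c| <= u) -> #|part R| <= #|R| * u.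
  move=> Ru; apply: (card_le_fibers (f := block_of2)) => [x|c cR].
    by rewrite inE => /andP[].
  by rewrite partE ?Ru.
pose W := [set c in square m | k <= #|columns A c|].
pose V := [set c in square m | k <= #|rows A c|].
pose U := [set c in contraction A | (#|columns A c| < k) && (#|rows A c| < k)].
have AUVW : A \subset part U :|: (part V :|: part W).
  apply/subsetP => x xA; have xC : block_of2 x \in contraction A by apply: imset_f.
  rewrite !(inE, xA, xC) /=.
  have := subsetP (contraction_square sA) _ xC; rewrite inE /= => ->.
  by do 2![rewrite ltnNge; case: (k <= _)].
apply: leq_trans (subset_leq_card AUVW) _.
apply: leq_trans (leq_card_setU _ _) _; apply: leq_add.
  apply: (@leq_trans (#|U| * k ^ 2)).
    apply: card_part => c; rewrite inE => /and3P[_ /ltnW ck /ltnW rk].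
    by apply: leq_trans (card_block_rows_columns _ _) _; rewrite leq_mul.
  by rewrite leq_mul2r subset_leq_card ?orbT //; apply/subsetP => c; rewrite inE => /andP[].
apply: leq_trans (leq_card_setU _ _) _.
have -> : 2 ^ b * k * b ^ 2 * 2 * m = m * (2 ^ b * k) * b ^ 2 + m * (2 ^ b * k) * b ^ 2.
  by move: (2 ^ b * k) (b ^ 2) => v w; lia.
apply: leq_add.
  apply: leq_trans (card_part V _ (fun c _ => card_block A c)) _.
  by rewrite leq_mul2r (few_tall_blocks m avoid) ?orbT.
apply: leq_trans (card_part W _ (fun c _ => card_block A c)) _.
by rewrite leq_mul2r (few_wide_blocks m avoid) ?orbT.
Qed.

Definition avoiders s m : {set {set 'I_N * 'I_N}} :=
  [set A : {set 'I_N * 'I_N} | (A \subset square m) && ~~ mx_contains s A].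

(** A matrix is determined by its contraction together with its restriction to
    the nonzero blocks. *)
Lemma card_avoiders_contraction s m u :
  (forall A, A \in avoiders s m -> #|A| <= u) ->
  #|avoiders s (b * m)| <= #|avoiders s m| * 2 ^ (u * b ^ 2).
Proof.
move=> Au; apply: (card_le_fibers (f := contraction)) => [A|B Bm].
  rewrite !inE => /andP[sA avoid]; rewrite contraction_square //=.
  by apply: contra avoid; apply: contraction_contains.
apply: (@leq_trans #|powerset [set x | block_of2 x \in B]|).
  apply/subset_leq_card/subsetP => A; rewrite !inE => /andP[_ /eqP <-].
  by apply/subsetP => x xA; rewrite inE imset_f.
rewrite card_powerset leq_exp2l //.
apply: (@leq_trans (#|B| * b ^ 2)); last by rewrite leq_mul2r Au ?orbT.
apply: (card_le_fibers (f := block_of2)) => [x|c cB]; first by rewrite inE.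
apply: leq_trans (card_block setT c).
by apply/subset_leq_card/subsetP => x; rewrite !inE => /andP[].
Qed.
End Fixed.
Arguments avoiders N s m : clear implicits.

(** The block size must exceed [k ^ 2] for the recurrence to give a linear bound,
    and be at least [2] for the exponents of [card_avoiders] to add up. *)
Let b := (k ^ 2).+2.
Let c := (2 ^ b * k * b ^ 2 * 2).+1.

(** For the largest number [a m] of entries of an avoiding matrix of size [m],
    the recurrence reads [a (b * m) <= k ^ 2 * a m + c.-1 * m], and
    [k ^ 2 * c + c.-1 <= b * c]. *)
Lemma marcus_tardos N (s : 'S_k) j (A : {set 'I_N * 'I_N}) :
  A \in avoiders N s (b ^ j) -> #|A| <= c * b ^ j.
Proof.
elim: j A => [|j IHj] A; rewrite inE => /andP[sA avoid].
  rewrite muln1; apply: (@leq_trans 1) => //.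
  apply/card_le1P => x xA y; rewrite inE; apply/idP/eqP => [yA|-> //].
  move/subsetP: sA => sA; move: (sA _ xA) (sA _ yA).
  case: x y {xA yA} => [x1 x2] [y1 y2]; rewrite !inE /= expn0 !ltnS !leqn0.
  move=> /andP[/eqP x10 /eqP x20] /andP[/eqP y10 /eqP y20].
  by congr (_, _); apply: val_inj; rewrite /= ?x10 ?x20 ?y10 ?y20.
rewrite expnS in sA; have b0 : 0 < b by [].
have := card_avoid_contraction b0 sA avoid.
have /IHj : contraction b A \in avoiders N s (b ^ j).
  rewrite inE contraction_square //=.
  by apply: contra avoid; apply: contraction_contains.
rewrite (expnS b j) /c; move: (2 ^ b * k * b ^ 2 * 2) => e.
move: (b ^ j) => m le_a' /leq_trans; apply; rewrite /b => {IHj sA b0}.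
move: (contraction _ _) le_a' => A' le_a'; move: (k ^ 2) => k2.
apply: (@leq_trans (e.+1 * m * k2 + e * m)); last by nia.
by rewrite leq_add2r leq_mul2r le_a' orbT.
Qed.

(** Klazar's argument: by the linear bound, passing from size [b ^ j] to size
    [b ^ j.+1] multiplies the number of matrices by at most
    [2 ^ (b ^ 2 * c * b ^ j)], and these exponents form a geometric series. *)
Lemma card_avoiders N (s : 'S_k) j :
  #|avoiders N s (b ^ j)| <= 2 ^ (b ^ 2 * c * b ^ j).
Proof.
have b2 : 1 < b by [].
elim: j => [|j IHj].
  apply: (@leq_trans #|powerset (@square N 1)|).
    by apply/subset_leq_card/subsetP => A; rewrite !inE => /andP[].
  rewrite card_powerset leq_exp2l // muln1; apply: (@leq_trans 1); last by rewrite muln_gt0.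
  apply/card_le1P => -[x1 x2]; rewrite inE /= !ltnS !leqn0 => /andP[/eqP x10 /eqP x20] [y1 y2].
  rewrite !inE /= !ltnS !leqn0; apply/andP/eqP => [[/eqP y10 /eqP y20]|[-> ->]].
    by congr (_, _); apply: val_inj; rewrite /= ?x10 ?x20 ?y10 ?y20.
  by rewrite x10 x20.
rewrite expnS.
apply: leq_trans (@card_avoiders_contraction N b isT s _ _ (@marcus_tardos N s j)) _.
apply: leq_trans (leq_mul IHj (leqnn _)) _; rewrite -expnD leq_exp2l //.
have -> : c * b ^ j * b ^ 2 = b ^ 2 * c * b ^ j by rewrite mulnC mulnA.
by rewrite addnn -mul2n mulnCA leq_mul2l leq_mul2r b2 !orbT.
Qed.
End MarcusTardos.
Arguments avoiders {k} N s m.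

Lemma stanley_wilf (C : permset) (k : nat) (s : 'S_k) :
  perm_class C -> s \notin C k ->
  exists2 K, 0 < K & forall n, 0 < n -> #|C n| <= K ^ n.
Proof.
move=> hC sC.
set b := (k ^ 2).+2; set c := (2 ^ b * k * b ^ 2 * 2).+1.
exists (2 ^ (b ^ 2 * c * b)) => [|n n_gt0]; first by rewrite expn_gt0.
(* b ^ j is the least power of b exceeding n, so it is at most b * n. *)
pose j := (trunc_log b n).+1.
have /andP[le_bn lt_nb] := @trunc_log_bounds b n isT n_gt0.
have nN : n <= b ^ j by apply: ltnW.
pose graph (p : 'S_n) := [set (widen_ord nN i, widen_ord nN (p i)) | i : 'I_n].
have graph_inj : injective graph.
  move=> p q pq; apply/permP => i.
  have : (widen_ord nN i, widen_ord nN (p i)) \in graph q by rewrite -pq imset_f.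
  by move=> /imsetP[i' _ [/ord_inj -> /ord_inj]].
rewrite -(card_imset _ graph_inj).
apply: (@leq_trans #|avoiders (b ^ j)%N s (b ^ j)|).
  apply/subset_leq_card/subsetP => _ /imsetP[p pC ->].
  rewrite inE; apply/andP; split.
    by apply/subsetP => x _; rewrite inE !ltn_ord.
  apply: contra sC => /mx_containsP[f [g [fi gi fg]]]; apply: (hC _ _ _ _ pC).
  have {}fg i : exists i', (widen_ord nN i' == f i) && (widen_ord nN (p i') == g (s i)).
    by have /imsetP[i' _ [-> ->]] := fg i; exists i'; rewrite !eqxx.
  pose h i := xchoose (fg i).
  have hP i : (h i = f i :> nat) /\ (p (h i) = g (s i) :> nat).
    by have /andP[/eqP/(congr1 val)/= ? /eqP/(congr1 val)/= ?] := xchooseP (fg i).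
  exists h; split=> i i'.
    by case: (hP i) (hP i') => -> _ [-> _]; apply: fi.
  case: (hP i) (hP i') => _ -> [_ ->].
  case: (ltngtP (s i) (s i')) => [/gi -> //|/gi /ltnW|/val_inj ->]; last by rewrite ltnn.
  by rewrite leqNgt => /negbTE.
apply: leq_trans (card_avoiders _ _ _) _; rewrite -expnM leq_exp2l //.
by rewrite -[X in _ <= X]mulnA leq_mul2l [b ^ j]expnS leq_mul2l le_bn !orbT.
Qed.

(** * Rationality *)

(** From index [n0 + d] on, the coefficients of [q * a] are the sums of the
    recurrence, so [q * a] is a polynomial. *)
Lemma rational_of_linear_recurrence (F : fieldType) (a : nat -> F) (q : {poly F})
    (d n0 : nat) :
  (q`_0 != 0)%R -> size q <= d.+1 ->
  (forall n, n0 <= n -> (\sum_(i < d.+1) q`_i * a (n + d - i)%N = 0)%R) ->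
  rational_series a.
Proof.
move=> q0 sq rec.
exists (\poly_(n < (n0 + d)%N) series_mul (fun i => q`_i) a n)%R, q; split=> // n.
rewrite coef_poly; case: ltnP => // le_n.
have [m [n0m ->]] : exists m, n0 <= m /\ n = m + d by exists (n - d); lia.
rewrite -[RHS](rec m n0m) /series_mul.
have dm : d.+1 <= (m + d).+1 by lia.
rewrite (big_ord_widen _ (fun i => q`_i * a (m + d - i)%N)%R dm) [RHS]big_mkcond.
apply: eq_bigr => i _; case: ltnP => // di.
by rewrite nth_default ?mul0r // (leq_trans sq).
Qed.

(** By the Cayley-Hamilton theorem the sequence satisfies the recurrence given by
    the characteristic polynomial, whose reversal has constant term [1]. *)
Lemma rational_of_transfer_matrix (F : fieldType) (S : finType) (M : S -> S -> F)
    (v : nat -> S -> F) (u : S -> F) (a : nat -> F) (n0 : nat) :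
  (forall n s, v n.+1 s = \sum_t M s t * v n t)%R ->
  (forall n, n0 <= n -> a n = (\sum_s u s * v n s)%R) ->
  rational_series a.
Proof.
move=> vS av.
case: (posnP #|S|) => [S0|]; last first.
  case E: #|S| => [//|d] _.
  pose e (i : 'I_d.+1) : S := enum_val (cast_ord (esym E) i).
  have eb : bijective e.
    apply: bij_comp; first exact: enum_val_bij.
    by exists (cast_ord E) => i; apply: val_inj.
  pose Mx : 'M[F]_d.+1 := (\matrix_(i, j) M (e i) (e j))%R.
  pose vx n : 'cV[F]_d.+1 := (\col_i v n (e i))%R.
  pose ux : 'rV[F]_d.+1 := (\row_i u (e i))%R.
  have vxS n m : vx (n + m) = (Mx ^+ m *m vx n)%R.
    elim: m => [|m IHm]; first by rewrite addn0 expr0 mul1mx.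
    rewrite addnS exprS -mulmxA -IHm; apply/colP => i; rewrite !mxE vS.
    by rewrite (reindex e) /=; [apply: eq_bigr => j _; rewrite !mxE | exact: onW_bij].
  have ax n : n0 <= n -> a n = ((ux *m vx n) ord0 ord0)%R.
    move=> n0n; rewrite mxE av //.
    by rewrite (reindex e) /=; [apply: eq_bigr => j _; rewrite !mxE | exact: onW_bij].
  pose chi := char_poly Mx.
  have szchi : size chi = d.+2 by rewrite size_char_poly.
  apply: (@rational_of_linear_recurrence _ _ (\poly_(i < d.+2) chi`_(d.+1 - i))%R d.+1 n0).
  - rewrite coef_poly /= subn0.
    have /monicP := char_poly_monic Mx; rewrite /lead_coef -/chi szchi /= => ->.
    exact: oner_neq0.
  - exact: size_poly.
  - move=> n n0n.

    have chiM : (\sum_(i < d.+2) chi`_i *: Mx ^+ i = 0)%R.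
      rewrite -[RHS](Cayley_Hamilton Mx) -/chi /horner_mx /horner_morph.
      rewrite (@horner_coef_wide _ d.+2) ?(leq_trans (size_poly _ _)) ?szchi //.
      by apply: eq_bigr => i _; rewrite coef_map /= [(_ * _)%R]mul_scalar_mx.

    pose l (B : 'M[F]_d.+1) := ((ux *m (B *m vx n)) ord0 ord0)%R.
    rewrite (reindex_inj rev_ord_inj) /=.
    transitivity (l (\sum_(i < d.+2) chi`_i *: Mx ^+ i)%R); last first.
      by rewrite chiM /l mul0mx mulmx0 mxE.
    rewrite /l mulmx_suml mulmx_sumr summxE; apply: eq_bigr => i _.
    rewrite coef_poly -scalemxAl -scalemxAr mxE -vxS.
    have id := ltn_ord i.
    rewrite (_ : d.+2 - i.+1 < d.+2); last by lia.
    congr (_ * _)%R; first by congr (_`_ _)%R; lia.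
    by rewrite ax; [congr ((_ *m vx _) _ _)%R; lia | lia].
apply: (@rational_of_linear_recurrence _ a 1%R 0 n0).
- by rewrite coef1 oner_neq0.
- by rewrite size_poly1.
move=> n n0n; rewrite big_ord1 addn0 subn0 av //.
rewrite big1 ?mulr0 // => s _.
by have := card0_eq S0 s; rewrite inE.
Qed.

(** * Heights of cuts *)

(** The entries of [B] at or after the cut [q] that lie below an entry of [B]
    before the cut. The set [B] is there to compare a permutation with what
    remains of it when only the positions of [B] are kept. *)
Definition pending (n : nat) (p : 'S_n) (B : {set 'I_n}) (q : nat) : {set 'I_n} :=
  [set j in B | (q <= j) && [exists l in B, (l < q) && (p j < p l)]].

Definition height (n : nat) (p : 'S_n) (q : nat) : nat := #|pending p setT q|.

Definition lehmer (n : nat) (p : 'S_n) (i : 'I_n) : nat :=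
  #|[set j : 'I_n | (i < j) && (p j < p i)]|.

(** The remaining entries that are pending are the [h] lowest ones. A letter
    [c < h] picks one of them; otherwise the entry read is a new maximum, with
    exactly [c] remaining entries below it. *)
Definition step (h c : nat) : nat := if c < h then h.-1 else c.

Section Heights.
Variables (n : nat) (p : 'S_n).
Implicit Types (B : {set 'I_n}) (i j l d : 'I_n) (q : nat).

Lemma pendingP B q j :
  reflect [/\ j \in B, q <= j & exists l, [/\ l \in B, l < q & p j < p l]]
          (j \in pending p B q).
Proof.
rewrite inE; apply: (iffP and3P) => -[jB qj].
  by move=> /existsP[l /and3P[? ? ?]]; split=> //; exists l.
by move=> [l [? ? ?]]; split=> //; apply/existsP; exists l; apply/and3P.
Qed.

Lemma pendingTP q j :
  reflect (q <= j /\ exists l, l < q /\ p j < p l) (j \in pending p setT q).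
Proof.
apply: (iffP (pendingP _ _ _)) => [[_ ? [l [_ ? ?]]]|[? [l [? ?]]]].
  by split=> //; exists l.
by split; rewrite ?inE //; exists l; rewrite ?inE.
Qed.

Lemma height0 : height p 0 = 0.
Proof. by apply: eq_card0 => j; apply/negP => /pendingTP[_ [l []]]. Qed.

Lemma height_size : height p n = 0.
Proof.
by apply: eq_card0 => j; apply/negP => /pendingTP[]; rewrite leqNgt ltn_ord.
Qed.

Lemma perm_val_lt i j : ~~ (p i < p j) -> i != j -> p j < p i.
Proof.
rewrite -leqNgt leq_eqVlt => /orP[/eqP/val_inj/perm_inj ->|//].
by rewrite eqxx.
Qed.

Lemma pending_self i : (i \in pending p setT i) = (lehmer p i < height p i).
Proof.
apply/idP/idP => [/pendingTP[_ [l [li pl]]]|].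
  apply: (@leq_trans #|i |: [set j : 'I_n | (i < j) && (p j < p i)]|).
    by rewrite cardsU1 !inE ltnn.
  apply/subset_leq_card/subsetP => j; rewrite !inE -/(pending _ _ _).
  move=> /orP[/eqP ->|/andP[ij pij]]; rewrite ?leqnn ?(ltnW ij) /=;
    apply/existsP; exists l; rewrite inE li //=.
  exact: ltn_trans pij pl.
apply: contraTT => ip; rewrite -leqNgt.
apply/subset_leq_card/subsetP => j /pendingTP[ij [l [li pjl]]].
have ji : j != i by apply: contra ip => /eqP <-; apply/pendingTP; split=> //; exists l; split=> //; lia.
have ij' : i < j by move: ji; rewrite -val_eqE /=; lia.
rewrite inE ij' /=.
apply: ltn_trans pjl _; apply: perm_val_lt; last by apply: contraTneq li => ->; rewrite ltnn.
by apply: contra ip => pil; apply/pendingTP; split=> //; exists l.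
Qed.

Lemma height_step i : height p i.+1 = step (height p i) (lehmer p i).
Proof.
rewrite /step -pending_self; case: ifPn => [iP|iNP].
  rewrite [height p i](cardsD1 i) iP /= /height; congr #|pred_of_set _|.
  case/pendingTP: (iP) => _ [m [mi pim]].
  apply/setP => j; rewrite in_setD1; apply/pendingTP/andP => [[ij [l [li pjl]]]|[ji]].
    split; first by apply: contraTneq ij => ->; rewrite ltnn.
    apply/pendingTP; split; first exact: ltnW.
    move: li; rewrite ltnS leq_eqVlt => /orP[/eqP/val_inj li|li]; last by exists l.
    by exists m; split=> //; rewrite li in pjl; apply: ltn_trans pim.
  move=> /pendingTP[ij [l [li pjl]]]; split; first by move: ji; rewrite -val_eqE /=; lia.
  by exists l; split=> //; apply: ltnW.
congr #|pred_of_set _|; apply/setP => j; rewrite [RHS]inE.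
apply/pendingTP/andP => [[ij [l [li pjl]]]|[ij pij]]; last by split=> //; exists i.
split=> //; move: li; rewrite ltnS leq_eqVlt => /orP[/eqP/val_inj <- //|li].
apply: ltn_trans pjl _; apply: perm_val_lt; last by apply: contraTneq li => ->; rewrite ltnn.
by apply: contra iNP => pil; apply/pendingTP; split=> //; exists l.
Qed.

(** An entry that is not pending at [q] has all the entries pending there below
    it. Each of them either comes after [d], and is counted by the letter of [d],
    or lies between [q] and [d]. *)
Lemma pending_of_lehmer d q : q <= d -> lehmer p d + (d - q) < height p q ->
  d \in pending p setT q.
Proof.
move=> qd; apply: contraTT => dNP; rewrite -leqNgt.
apply: (@leq_trans #|[set j : 'I_n | (d < j) && (p j < p d)] :|: [set j : 'I_n | q <= j < d]|).
  apply/subset_leq_card/subsetP => j /pendingTP[qj [l [lq pjl]]].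
  rewrite !inE qj /=; case: (ltngtP j d) => [//|dj|/val_inj jd]; rewrite ?orbF /=.
    apply: ltn_trans pjl _; apply: perm_val_lt; last by apply/eqP => /(congr1 val)/=; lia.
    by apply: contra dNP => pdl; apply/pendingTP; split=> //; exists l.
  by case/negP: dNP; apply/pendingTP; split=> //; exists l; rewrite -jd.
apply: leq_trans (leq_card_setU _ _) _; rewrite leq_add2l.
have -> : [set j : 'I_n | q <= j < d] = [set j : 'I_n | j < d] :\: [set j : 'I_n | j < q].
  by apply/setP => j; rewrite !inE -leqNgt.
have dn := ltn_ord d.
rewrite cardsD card_ord_lt ?(ltnW dn) // (setIidPr _) ?card_ord_lt //; first by lia.
by apply/subsetP => j; rewrite !inE => /leq_trans; apply.
Qed.

Lemma pending_delete_lt d q : d \in pending p setT q ->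
  #|pending p [set~ d] q| < height p q.
Proof.
move=> dP; rewrite [height p q](cardsD1 d) dP ltnS.
apply/subset_leq_card/subsetP => j /pendingP[]; rewrite !inE => jd qj [l [_ lq pjl]].
by rewrite jd qj /=; apply/existsP; exists l; rewrite inE lq.
Qed.

(** If the [e] entries following [d] were already pending when [d] was read, then
    without [d] nothing new becomes pending while they are read: what is pending
    after them was pending at [d], and they are gone. *)
Lemma pending_delete_jump d e : d + e < n ->
  (forall i, d < i <= d + e -> i \in pending p setT d) ->
  #|pending p [set~ d] (d + e).+1| <= height p d - e.
Proof.
move=> den old.
have sub : [set i : 'I_n | d < i <= d + e] \subset pending p setT d.
  by apply/subsetP => i; rewrite inE; apply: old.
have card_old : #|[set i : 'I_n | d < i <= d + e]| = e.
  have -> : [set i : 'I_n | d < i <= d + e] = [set i : 'I_n | i < (d + e).+1] :\: [set i : 'I_n | i < d.+1].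
    by apply/setP => j; rewrite !inE -leqNgt.
  rewrite cardsD card_ord_lt // (setIidPr _) ?card_ord_lt //; first by lia.
  by apply/subsetP => j; rewrite !inE; lia.
rewrite -{2}card_old -cardsDS //; apply/subset_leq_card/subsetP => j.
move=> /pendingP[jd qj [l [ld lq pjl]]]; rewrite !inE in jd ld.
rewrite in_setD inE; apply/andP; split; first by lia.
apply/pendingTP; split; first by lia.
have [ltd|led] := ltnP l d; first by exists l.
have lq' : d < l <= d + e by move: ld; rewrite -val_eqE /=; lia.
have /pendingTP[_ [m [md plm]]] := old l lq'.
by exists m; split=> //; apply: ltn_trans plm.
Qed.
End Heights.

Lemma pending_mono n (p : 'S_n) (B B' : {set 'I_n}) q : B \subset B' ->
  pending p B q \subset pending p B' q.
Proof.
move=> /subsetP BB; apply/subsetP => j /pendingP[/BB jB qj [l [/BB lB lq pl]]].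
by apply/pendingP; split=> //; exists l.
Qed.

Section Containment.
Variables (k n : nat) (s : 'S_k) (p : 'S_n) (f : 'I_k -> 'I_n).
Hypothesis fi : increasing f.
Hypothesis fs : forall i j : 'I_k, (s i < s j) = (p (f i) < p (f j)).

(** An embedding [f] of [s] in [p] sends each cut of [p] to the cut of [s] that
    has before it the entries mapped before the given cut. *)
Definition pull_cut (q : nat) : nat := #|[set i | f i < q]|.

Lemma pull_cutE (i : 'I_k) q : (i < pull_cut q) = (f i < q).
Proof.
case: (ltnP (f i) q) => [fq|qf].
  rewrite -(@card_ord_lt k i.+1) //; apply/subset_leq_card/subsetP => j.
  by rewrite !inE ltnS leq_eqVlt => /orP[/eqP/val_inj -> //|/fi/ltn_trans]; apply.
apply/negbTE; rewrite -leqNgt -[X in _ <= X](@card_ord_lt k i) ?(ltnW (ltn_ord i)) //.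
apply/subset_leq_card/subsetP => j; rewrite !inE => fjq.
by rewrite -(increasing_mono j i fi); apply: leq_trans qf.
Qed.

Lemma height_pull q : height s (pull_cut q) <= #|pending p (f @: setT) q|.
Proof.
rewrite /height -(card_imset _ (increasing_inj fi)).
apply/subset_leq_card/subsetP => _ /imsetP[i + ->] => /pendingTP[qi [l [lq sil]]].
apply/pendingP; split; first exact: imset_f.
  by move: qi; rewrite leqNgt pull_cutE -leqNgt.
by exists (f l); rewrite imset_f // -pull_cutE -fs.
Qed.

(** The last cut of [p] that is sent to the cut [q] of [s]. It is the cut just
    before the image of the [q]-th entry, or the final cut [n] when [q = k]. *)
Definition push_cut (q : nat) : nat := if insub q is Some i then f i else n.

Lemma push_cutK q : q <= k -> pull_cut (push_cut q) = q.
Proof.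
rewrite /push_cut leq_eqVlt => /orP[/eqP->|qk]; last first.
  rewrite insubT /= /pull_cut.
  under eq_finset => i do rewrite (increasing_mono i _ fi) /=.
  by rewrite card_ord_lt // ltnW.
rewrite insubF ?ltnn // /pull_cut -[RHS]card_ord; apply: eq_card => i.
by rewrite !inE ltn_ord.
Qed.

Lemma push_cut_lt q1 q2 : q1 < q2 -> q2 <= k -> push_cut q1 < push_cut q2.
Proof.
move=> q12 q2k; rewrite /push_cut.
case: insubP => [i _ iq|]; last by rewrite (leq_trans q12 q2k).
by case: insubP => [j _ jq|_ //]; rewrite increasing_mono //= iq jq.
Qed.

Lemma push_cut_le q : push_cut q <= n.
Proof. by rewrite /push_cut; case: insubP => // i _ _; apply: ltnW. Qed.

Lemma height_contained q : q <= k -> height s q <= height p (push_cut q).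
Proof.
move=> qk; rewrite -{1}(push_cutK qk); apply: leq_trans (height_pull _) _.
exact/subset_leq_card/pending_mono/subsetT.
Qed.

Lemma pull_cut_mono q1 q2 : q1 <= q2 -> pull_cut q1 <= pull_cut q2.
Proof.
move=> q12; apply/subset_leq_card/subsetP => i; rewrite !inE => /leq_trans.
exact.
Qed.
End Containment.

(** * Lehmer codes and the automaton *)

Definition code (n : nat) (p : 'S_n) : seq nat := [seq lehmer p i | i : 'I_n].

Lemma size_code n (p : 'S_n) : size (code p) = n.
Proof. by rewrite size_map -cardT card_ord. Qed.

Lemma nth_code n (p : 'S_n) (i : 'I_n) : nth 0 (code p) i = lehmer p i.
Proof.
by rewrite (nth_map i) ?nth_ord_enum // -cardT card_ord.
Qed.

Lemma card_perm_lt n (p : 'S_n) (m : nat) : m <= n -> #|[set j | p j < m]| = m.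
Proof.
move=> mn; rewrite -[RHS](card_ord_lt mn) -[RHS](card_preimset _ (@perm_inj _ p)).
by apply: eq_card => j; rewrite !inE.
Qed.

Lemma lehmer_lift0 n (c : 'I_n.+1) (p : 'S_n) :
  lehmer (lift_perm ord0 c p) ord0 = c.
Proof.
rewrite -[RHS](card_perm_lt (lift_perm ord0 c p) (ltnW (ltn_ord c))).
apply: eq_card => j; rewrite !inE lift_perm_id lt0n.
by case: eqVneq => [/= j0|//]; rewrite (_ : j = ord0) ?lift_perm_id ?ltnn //; apply: val_inj.
Qed.

Lemma lehmer_lift n (c : 'I_n.+1) (p : 'S_n) (i : 'I_n) :
  lehmer (lift_perm ord0 c p) (lift ord0 i) = lehmer p i.
Proof.
rewrite /lehmer -[RHS](card_imset _ (@lift_inj _ ord0)); apply: eq_card => j.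
have lift_lt (d : 'I_n.+1) (a b : 'I_n) : (lift d a < lift d b) = (a < b).
  by rewrite /= !ltnNge leq_bump2.
case: (unliftP ord0 j) => [j' ->|->].
  by rewrite (mem_imset _ _ (@lift_inj _ ord0)) !inE !lift_perm_lift !lift_lt.
rewrite inE /=; apply/esym/imsetP => -[j' _] /(congr1 val) /=.
by rewrite /bump.
Qed.

(** Removing the first entry of a permutation removes the first letter of its
    code, which allows induction on the length along [lift_perm_bij]. *)
Lemma code_lift n (c : 'I_n.+1) (p : 'S_n) :
  code (lift_perm ord0 c p) = nat_of_ord c :: code p.
Proof.
rewrite /code /image_mem enum_ordSl /= lehmer_lift0 -map_comp; congr (_ :: _).
by apply: eq_map => i; rewrite /= lehmer_lift.
Qed.

Lemma lift_perm_bij n :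
  bijective (fun x : 'I_n.+1 * 'S_n => lift_perm ord0 x.1 x.2).
Proof.
apply: inj_card_bij => [[c p] [d q] /= eq_l|].
  have cd : c = d by rewrite -(lift_perm_id ord0 c p) eq_l lift_perm_id.
  rewrite cd in eq_l *; congr (_, _); apply/permP => i.
  by apply: (@lift_inj _ d); rewrite -!(lift_perm_lift ord0) eq_l.
by rewrite card_prod card_ord !card_Sn factS.
Qed.

Lemma code_surj (w : seq nat) :
  (forall i, i < size w -> nth 0 w i + i < size w) ->
  exists p : 'S_(size w), code p = w.
Proof.
elim: w => [|c w IHw] wP; first by exists 1%g; apply: size0nil; rewrite size_code.
have [i iw|p pw] := IHw; first by have := wP i.+1 iw; rewrite /=; lia.
have cw : c < (size w).+1 by have := wP 0 isT; rewrite addn0.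
by exists (lift_perm ord0 (Ordinal cw) p); rewrite code_lift pw.
Qed.

Definition run (h : nat) (w : seq nat) : nat := foldl step h w.

Lemma run_cat h u v : run h (u ++ v) = run (run h u) v.
Proof. exact: foldl_cat. Qed.

Lemma height_code n (p : 'S_n) q : q <= n -> height p q = run 0 (take q (code p)).
Proof.
elim: q => [|q IHq] qn; first by rewrite height0 take0.
have qn' : q < size (code p) by rewrite size_code.
rewrite (take_nth 0 qn') -cats1 run_cat -IHq ?(ltnW qn) //.
by rewrite -[q]/(val (Ordinal qn)) nth_code height_step.
Qed.

Lemma step_ge h c : h.-1 <= step h c /\ c <= step h c.
Proof. by rewrite /step; case: ltnP; lia. Qed.

Lemma run_size h w : h <= run h w + size w.
Proof.
elim: w h => [|c w IHw] h /=; first by lia.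
by have := IHw (step h c); case: (step_ge h c); lia.
Qed.

(** The height never drops by more than one per letter and is at least the last
    letter read. As it ends at [0], no letter exceeds the number of letters that
    follow it. *)
Lemma code_exists n (w : seq nat) : size w = n -> run 0 w = 0 ->
  exists p : 'S_n, code p = w.
Proof.
move=> wn w0; rewrite -wn; apply: code_surj => i iw.
have := run_size (run 0 (take i.+1 w)) (drop i.+1 w).
rewrite -run_cat cat_take_drop w0 size_drop (take_nth 0 iw) -cats1 run_cat /=.
by case: (step_ge (run 0 (take i w)) (nth 0 w i)); lia.
Qed.

Section Automaton.
Variables (F P : nat).

(** The flag [f] tells whether some earlier height equal to [P] has been followed
    by heights at least [F] only. Ending at height [0] is automatic for the code
    of a permutation started at height [0]. Asking for it makes the count of
    accepted permutations of length [n] vanish for initial heights above [n], so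
    that the recurrence needs no side condition. *)
Fixpoint accept (h : nat) (f : bool) (w : seq nat) : bool :=
  [&& h <= P, ~~ (f && (h == P)) &
    if w is c :: w' then accept (step h c) ((h == P) || f && (F <= h)) w'
    else h == 0].

Lemma accept_size h f w : accept h f w -> h <= size w.
Proof.
elim: w h f => [|c w IHw] h f /= /and3P[_ _]; first by move/eqP->.
by move/IHw; case: (step_ge h c); lia.
Qed.

Lemma accept_le h f w : accept h f w -> h <= P.
Proof. by case: w => [|c w] /= /and3P[]. Qed.

Lemma card_accept_rec n h f :
  #|[set p : 'S_n.+1 | accept h f (code p)]| =
    ((h <= P) && ~~ (f && (h == P))) *
    \sum_(c < n.+1) #|[set p : 'S_n |
      accept (step h c) ((h == P) || f && (F <= h)) (code p)]|.
Proof.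
have [g gK Kg] := lift_perm_bij n.
set ok := (h <= P) && _; set f' := _ || _.
have accE (c : 'I_n.+1) (p : 'S_n) : accept h f (code (lift_perm ord0 c p)) =
    ok && accept (step h c) f' (code p).
  by rewrite code_lift /= -andbA.
case okE: ok; last first.
  apply: eq_card0 => p; rewrite inE -(Kg p); case: (g p) => c p'.
  by rewrite accE okE.
rewrite mul1n -sum1dep_card (reindex _ (onW_bij _ (lift_perm_bij n))) /=.
under eq_bigl => x do rewrite accE okE /=.
rewrite -(pair_big_dep xpredT (fun c p => accept (step h (nat_of_ord c)) f' (code p)) (fun _ _ => 1)) /=.
by apply: eq_bigr => c _; rewrite sum1dep_card.
Qed.

(** Letters above [P] lead to heights above [P], and letters above [n] to heights
    that cannot return to [0] in [n] steps. Hence the range of the letter may be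
    taken independent of [n], which turns the recurrence into a fixed matrix. *)
Lemma card_accept_letters n h f :
  #|[set p : 'S_n.+1 | accept h f (code p)]| =
    ((h <= P) && ~~ (f && (h == P))) *
    \sum_(c < P.+1) #|[set p : 'S_n |
      accept (step h c) ((h == P) || f && (F <= h)) (code p)]|.
Proof.
rewrite card_accept_rec; case: leqP => //= hP; congr (_ * _).
set f' := _ || _; pose G c := #|[set p : 'S_n | accept (step h c) f' (code p)]|.
rewrite -[LHS]/(\sum_(c < n.+1) G c) -[RHS]/(\sum_(c < P.+1) G c).
have G0 c m : (m = n \/ m = P) -> m.+1 <= c -> G c = 0.
  move=> mE mc; apply: eq_card0 => p; rewrite inE; apply/negP => acc.
  have := accept_size acc; rewrite size_code; have := accept_le acc.
  by case: (step_ge h c); rewrite /step; case: ltnP; lia.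
have widen m M : (m = n \/ m = P) -> m.+1 <= M -> \sum_(c < m.+1) G c = \sum_(c < M) G c.
  move=> mE mM; rewrite (big_ord_widen _ G mM) big_mkcond; apply: eq_bigr => c _.
  by case: ltnP => // /(G0 _ _ mE) ->.
by rewrite (widen n (maxn n P).+1) ?(widen P (maxn n P).+1) ?ltnS ?leq_maxl ?leq_maxr; auto.
Qed.

Definition has_long_plateau (h : nat -> nat) (n : nat) : Prop :=
  exists q1 q2, [/\ q1 < q2 <= n, P <= h q1, P <= h q2 &
    forall q, q1 <= q <= q2 -> F <= h q].

Hypothesis FP : F < P.

(** A plateau either lies after the current cut, or starts at an earlier cut
    remembered by the flag. *)
Lemma acceptP (h : nat) (f : bool) (w : seq nat) :
  let ht i := run h (take i w) in
  reflect [/\ forall i, i <= size w -> ht i <= P,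
              ht (size w) = 0, ~ has_long_plateau ht (size w)
            & f -> ~ exists2 q, q <= size w /\ P <= ht q &
                       forall i, i <= q -> F <= ht i]
          (accept h f w).
Proof.
elim: w h f => [|c w IHw] h f ht.
  apply: (iffP and3P) => [[hP fP /eqP h0]|[hP h0 _ _]].
    split=> //; first by case=> [q1 [q2 [/=]]]; lia.
    by move=> ft [q [_]]; rewrite /ht /run /= h0; lia.
  have hh : h = 0 by have := h0.
  by rewrite hh; split=> //; rewrite andbC; case: eqP => //; lia.
have htS i : ht i.+1 = run (step h c) (take i w) by [].
have ht0 : ht 0 = h by [].
rewrite /=; apply: (iffP and3P) => [[hP fP /IHw[] all_le fin noplat noflag]|].
  split=> //.
  - by case=> [|i]; rewrite ?ht0 // htS; apply: all_le.
  - case=> [q1 [q2 [/andP[q12 q2w] P1 P2 Fq]]].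
    case: q1 q2 => [|q1] [|q2] // in q12 q2w P1 P2 Fq *.
      apply: noflag; first by apply/orP; left; rewrite eqn_leq hP -ht0.
      exists q2 => // i iq; rewrite -htS; apply: Fq; lia.
    apply: noplat; exists q1, q2; split=> //; first by lia.
    by move=> q qq; rewrite -htS; apply: Fq; lia.
  - move=> ft [q [qw Pq] Fq]; case: q => [|q] in qw Pq Fq *.
      by move: fP; rewrite ft; case: eqP => //; rewrite ht0 in Pq; lia.
    apply: noflag; first by rewrite ft -ht0 Fq ?orbT.
    by exists q => // i iq; rewrite -htS; apply: Fq.
move=> [all_le fin noplat noflag].
have hP : h <= P by rewrite -ht0 all_le.
split=> //.
  apply/negP => /andP[ft /eqP hP']; apply: (noflag ft); exists 0; first by rewrite ht0 hP'.
  by case=> // _; rewrite ht0; lia.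
apply/IHw; split=> //.
- by move=> i iw; rewrite -htS; apply: all_le.
- move=> [q1 [q2 [q12 P1 P2 Fq]]]; apply: noplat.
  exists q1.+1, q2.+1; split=> // q qq.
  by case: q qq => [|q] qq; [lia | rewrite htS; apply: Fq].
- move=> f' [q [qw Pq] Fq]; case: (eqVneq h P) f' => [hP' _|_ /= /andP[ft Fh]].
    apply: noplat; exists 0, q.+1; split=> // [|i]; first by rewrite ht0 hP'.
    by case: i => [|i] iq; [rewrite ht0; lia | rewrite htS; apply: Fq].
  apply: (noflag ft); exists q.+1 => // i.
  by case: i => [|i] iq; [rewrite ht0 | rewrite htS; apply: Fq].
Qed.

Definition plateau_free : permset := fun n => [set p | accept 0 false (code p)].

Lemma plateau_freeP n (p : 'S_n) :
  reflect ((forall q, q <= n -> height p q <= P) /\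
           ~ has_long_plateau (height p) n)
          (p \in plateau_free n).
Proof.
rewrite inE; apply: (iffP (acceptP _ _ _)); rewrite size_code.
  case=> all_le _ noplat _; split=> [q qn|[q1 [q2 [q12 P1 P2 Fq]]]].
    by rewrite height_code // all_le.
  apply: noplat; exists q1, q2; split=> //; try by rewrite -height_code //; lia.
  by move=> q qq; rewrite -height_code ?Fq //; lia.
case=> all_le noplat; split=> //.
- by move=> i ni; rewrite -height_code // all_le.
- by rewrite -height_code // height_size.
- move=> [q1 [q2 [q12 P1 P2 Fq]]]; apply: noplat.
  exists q1, q2; split=> //; try by rewrite height_code //; lia.
  by move=> q qq; rewrite height_code ?Fq //; lia.
Qed.

End Automaton.

(** * Minimal plateaus *)

Lemma run_decreasing h w : all (fun c => c + size w <= h) w -> run h w = h - size w.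
Proof.
elim: w h => [|c w IHw] h /=; first by rewrite subn0.
move=> /andP[ch wh]; rewrite /step ifT; last by lia.
rewrite -/(run _ _) IHw; first by lia.
by apply: sub_all wh => a /=; lia.
Qed.

Lemma run_zeros h m : m <= h -> run h (nseq m 0) = h - m.
Proof.
by move=> mh; rewrite run_decreasing size_nseq // all_nseq add0n mh orbT.
Qed.

Lemma flatten_split (T : Type) (bs : seq (seq T)) i : i < size (flatten bs) ->
  exists u b v, [/\ bs = u ++ b :: v, size (flatten u) <= i &
                    i < size (flatten u) + size b].
Proof.
elim: bs i => [//|b bs IHbs] i; rewrite /= size_cat => ib.
case: (ltnP i (size b)) => [ib'|bi]; first by exists [::], b, bs.
have [|u [b' [v [-> ui iu]]]] := IHbs (i - size b); first by lia.
by exists (b :: u), b', v; split=> //=; rewrite size_cat; lia.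
Qed.

Lemma take_cat_addn (T : Type) (u v : seq T) i m : m = size u -> take (m + i) (u ++ v) = u ++ take i v.
Proof. by move=> ->; rewrite take_cat ltnNge leq_addr addKn. Qed.

Lemma nth_cat_addn (T : Type) x0 (u v : seq T) i m : m = size u -> nth x0 (u ++ v) (m + i) = nth x0 v i.
Proof. by move=> ->; rewrite nth_cat ltnNge leq_addr addKn. Qed.

(** A jump from height [F] to [F + e], with [e = size w], followed by [e] entries
    that bring the height back to [F]. The bound on the letters ensures that
    these entries were pending before the jump (see [pending_of_lehmer]). *)
Definition is_block (F P : nat) (b : seq nat) : bool :=
  if b is j :: w then [&& j == F + size w, 0 < size w, F + size w < P & all (fun c => c + size w < F) w]
  else false.

Definition plateau_word (F P : nat) (bs : seq (seq nat)) : seq nat :=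
  (P :: nseq (P - F) 0) ++ flatten bs ++ (P :: nseq P 0).

Lemma run_block F P b i : is_block F P b -> i < size b ->
  run F (take i.+1 b) = F + (size b).-1 - i.
Proof.
case: b => [//|j w] /and4P[/eqP -> w0 _ /allP wF] iw; rewrite /= /step ltnNge leq_addr /=.
rewrite -/(run _ _) run_decreasing size_take_min (minn_idPl _) //.
by apply/allP => c /mem_take/wF; rewrite /= in iw; lia.
Qed.

Lemma run_blocks F P bs : all (is_block F P) bs -> run F (flatten bs) = F.
Proof.
elim: bs => [//|b bs IHbs] /= /andP[bB bsB]; rewrite run_cat.
have b0 : 0 < size b by case: b bB.
by rewrite -[b]take_size -(prednK b0) (run_block bB) ?prednK // addnK IHbs.
Qed.

Section Plateaus.
Variables (F P : nat).
Local Notation X := (plateau_free F P).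

(** The plateau even lifts to the heights counted within the image of the
    embedding; this is what makes minimality work. *)
Lemma plateau_push k n (s : 'S_k) (p : 'S_n) (f : 'I_k -> 'I_n) :
  increasing f -> (forall i j : 'I_k, (s i < s j) = (p (f i) < p (f j))) ->
  has_long_plateau F P (height s) k ->
  has_long_plateau F P (fun q => #|pending p (f @: setT) q|) n.
Proof.
move=> fi fs [q1 [q2 [/andP[q12 q2k] P1 P2 Fq]]].
have q1k : q1 <= k by lia.
exists (push_cut f q1), (push_cut f q2); split.
- by rewrite push_cut_lt // push_cut_le.
- by apply: leq_trans P1 _; rewrite -{1}(push_cutK fi q1k); apply: height_pull.
- by apply: leq_trans P2 _; rewrite -{1}(push_cutK fi q2k); apply: height_pull.
move=> q /andP[q1q qq2]; apply: leq_trans (height_pull fi fs q); apply: Fq.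
by rewrite -[X in X <= _ <= _](push_cutK fi q1k) -[X in _ <= _ <= X](push_cutK fi q2k)
  !pull_cut_mono.
Qed.

Hypothesis FP : F < P.

Lemma plateau_free_class : perm_class X.
Proof.
move=> k n s p /(plateau_freeP FP)[all_le noplat] [f [fi fs]].
apply/(plateau_freeP FP); split=> [q qk|/(plateau_push fi fs)[q1 [q2 [q12 P1 P2 Fq]]]].
  by apply: leq_trans (height_contained fi fs qk) (all_le _ _); apply: push_cut_le.
have le_h q : #|pending p (f @: setT) q| <= height p q.
  exact/subset_leq_card/pending_mono/subsetT.
apply: noplat; exists q1, q2; split=> //; try exact: leq_trans (le_h _).
by move=> q /Fq/leq_trans; apply.
Qed.

(** The third clause puts [p] outside the class. The second and the fourth put
    everything properly contained in [p] inside it: heights stay bounded, and a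
    plateau surviving the deletion of [d] would have to end at the same two
    cuts. *)
Definition minimal_plateau n (p : 'S_n) : Prop :=
  exists Q, [/\ 1 < Q <= n,
    forall q, q <= n -> height p q <= P /\ (P <= height p q -> q = 1 \/ q = Q),
    [/\ P <= height p 1, P <= height p Q & forall q, 1 <= q <= Q -> F <= height p q]
  & forall d, exists2 q, 1 <= q <= Q &
      #|pending p [set~ d] q| < (if (q == 1) || (q == Q) then P else F)].

Lemma minimal_plateau_notin n (p : 'S_n) : minimal_plateau p -> p \notin X n.
Proof.
move=> [Q [Qn _ [P1 PQ Fq] _]]; apply/negP => /(plateau_freeP FP)[_]; apply.
by exists 1, Q.
Qed.

(** An embedding of a shorter permutation misses some entry [d]. A plateau of it
    would lift to one that does not use [d]. Its ends are cuts of height [P] of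
    [p], hence the cuts [1] and [Q], and this contradicts the fragility of the
    plateau under the deletion of [d]. *)
Lemma minimal_plateau_proper k n (s : 'S_k) (p : 'S_n) :
  minimal_plateau p -> contained s p -> k < n -> s \in X k.
Proof.
move=> [Q [/andP[Q1 Qn] all_le _ tight]] [f [fi fs]] kn.
apply/(plateau_freeP FP); split=> [q qk|/(plateau_push fi fs)[q1 [q2 [/andP[q12 q2n] P1 P2 Fq]]]].
  apply: leq_trans (height_contained fi fs qk) _.
  by have [] := all_le _ (push_cut_le f q).
have /existsP[d df] : [exists d, d \notin f @: setT].
  apply: contraLR kn; rewrite negb_exists -leqNgt => /forallP fT.
  rewrite -[n]card_ord -[k]card_ord -[X in _ <= X]cardsT.
  apply: leq_trans (leq_imset_card f setT); apply/subset_leq_card/subsetP => d _.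
  by have := fT d; rewrite negbK.
have le_d q : #|pending p (f @: setT) q| <= #|pending p [set~ d] q|.
  apply/subset_leq_card/pending_mono/subsetP => i iF; rewrite !inE.
  by apply: contraNneq df => <-.
have le_h q : #|pending p (f @: setT) q| <= height p q.
  exact/subset_leq_card/pending_mono/subsetT.
have [_ /(_ (leq_trans P1 (le_h _))) q1E] := all_le q1 (leq_trans (ltnW q12) q2n).
have [_ /(_ (leq_trans P2 (le_h _))) q2E] := all_le q2 q2n.
have {}q1E : q1 = 1 by lia.
have {}q2E : q2 = Q by lia.
have [q q1Q] := tight d; rewrite ltnNge => /negP; apply.
apply: leq_trans (le_d q); case: ifP => [/orP[]/eqP ->|_]; rewrite -?q1E -?q2E //.
by apply: Fq; rewrite q1E q2E.
Qed.

(** The witnesses for fragility are as follows. The initial jump and the entries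
    of the first descent are needed at cut [1], the final jump and the entries
    after it at the cut [Q] that follows this jump. In a block, a falling entry
    is pending at the cut before the block, where the height is [F]. Deleting
    the jump of the block lowers the height, again [F], at the cut after it:
    only old entries remain pending there, and at least one has been read. *)
Lemma plateau_word_minimal n (p : 'S_n) bs : 0 < F -> all (is_block F P) bs ->
  code p = plateau_word F P bs -> minimal_plateau p.
Proof.
move=> F_gt0 bsB cp.
(* L is the position of the first block, and J that of the final jump. *)
pose L := (P - F).+1; pose J := L + size (flatten bs).
have nE : n = J + P.+1.
  by rewrite -(size_code p) cp /plateau_word !size_cat /= !size_nseq; lia.
have hE q : q <= n -> height p q = run 0 (take q (plateau_word F P bs)).
  by rewrite -cp; apply: height_code.
have lE (i : 'I_n) : lehmer p i = nth 0 (plateau_word F P bs) i by rewrite -cp nth_code.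
have hL i : i <= P - F -> height p i.+1 = P - i.
  move=> iPF; rewrite hE; last by lia.
  rewrite /plateau_word /= take_cat size_nseq.
  have stepP : step 0 P = P by rewrite /step ltn0.
  case: ltnP => [_|Fi]; rewrite stepP -/(run _ _).
    by rewrite take_nseq ?run_zeros //; lia.
  have -> : i = P - F by lia.
  by rewrite subnn take0 cats0 run_zeros //; lia.
have runL : run 0 (P :: nseq (P - F) 0) = F.
  by rewrite /= /step ltn0 -/(run _ _) run_zeros; lia.
have szL : L = size (P :: nseq (P - F) 0) by rewrite /= size_nseq.
have hJ : height p J = F.
  rewrite hE; last by lia.
  by rewrite /plateau_word catA -[J]addn0 take_cat_addn ?size_cat -?szL // take0 cats0 run_cat runL (run_blocks (P := P)).
have hR i : i <= P -> height p (J + i.+1) = P - i.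
  move=> iP; rewrite hE; last by lia.
  rewrite /plateau_word catA take_cat_addn ?size_cat -?szL // !run_cat runL (run_blocks (P := P)) //=.
  have -> : step F P = P by rewrite /step ltnNge (ltnW FP).
  by rewrite -/(run _ _) take_nseq // run_zeros.
have lL (d : 'I_n) : 0 < d <= P - F -> lehmer p d = 0.
  move=> dPF; rewrite lE /plateau_word /=; case: (nat_of_ord d) dPF => // i /andP[_ iP].
  by rewrite /= nth_cat size_nseq iP nth_nseq iP.
have lR (d : 'I_n) : J < d -> lehmer p d = 0.
  move=> Jd; rewrite lE /plateau_word catA.
  have -> : nat_of_ord d = J + (d - J.+1).+1 by lia.
  by rewrite nth_cat_addn ?size_cat -?szL //= nth_nseq if_same.
have block (d : nat) : P - F < d -> d < J -> exists d0 e,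
    [/\ L <= d0 /\ d0 + e < J, d0 <= d <= d0 + e, 0 < e /\ F + e < P, height p d0 = F
      & (forall i, i <= e -> height p (d0 + i.+1) = F + e - i) /\
        (forall i : 'I_n, d0 < i <= d0 + e -> lehmer p i + e < F)].
  move=> PFd dJ; have [|u [b [v [bsE ud du]]]] := @flatten_split _ bs (d - L); first by lia.
  move: bsB; rewrite bsE all_cat /= => /and3P[uB bB vB].
  have WE : plateau_word F P bs = ((P :: nseq (P - F) 0) ++ flatten u) ++ b ++ flatten v ++ (P :: nseq P 0).
    by rewrite /plateau_word bsE flatten_cat /= -!catA.
  have szJ : J = L + size (flatten u) + size b + size (flatten v).
    by rewrite /J bsE flatten_cat size_cat /= size_cat; lia.
  have szu : L + size (flatten u) = size ((P :: nseq (P - F) 0) ++ flatten u).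
    by rewrite size_cat -szL.
  have b0 : 0 < size b by lia.
  have hb i : i <= size b -> height p (L + size (flatten u) + i) = run F (take i b).
    move=> ib; rewrite hE; last by lia.
    rewrite WE take_cat_addn // !run_cat runL (run_blocks (P := P)) //.
    by congr (run _ _); rewrite take_cat; case: ltnP => // bi; rewrite (_ : i - size b = 0) ?take0 ?cats0 ?take_oversize //; lia.
  exists (L + size (flatten u)), (size b).-1; split.
  - by lia.
  - by lia.
  - by case: b bB {hb bsE WE szJ b0 du} => [//|j w] /= /and4P[_ -> ->].
  - by rewrite -[X in height p X]addn0 hb // take0.
  split=> [i ib|i iP].
    by rewrite hb ?(run_block bB) //; lia.
  rewrite lE WE.
  have -> : nat_of_ord i = L + size (flatten u) + (i - (L + size (flatten u))) by lia.
  rewrite nth_cat_addn // nth_cat ifT; last by lia.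
  case: b bB iP {hb bsE WE szJ b0 du} => [//|j w] /= /and4P[_ _ _ /allP wF] iP.
  have -> : i - (L + size (flatten u)) = (i - (L + size (flatten u))).-1.+1 by lia.
  have iw : (i - (L + size (flatten u))).-1 < size w by lia.
  by apply: wF; apply: mem_nth.
have cover (d : nat) : d <= n -> [\/ d <= P - F, P - F < d /\ d < J | J <= d].
  move=> _; case: (leqP d (P - F)) => [|?]; first by constructor.
  by case: (leqP J d) => ?; [constructor 3 | constructor 2].
exists J.+1; split.
- by lia.
- case=> [|q] qn; first by rewrite height0; lia.
  case: (cover q (ltnW qn)) => [qP|[Pq qJ]|Jq].
  + by rewrite hL //; lia.
  + have [d0 [e [[? ?] dq [? ?] _ [hb _]]]] := block q Pq qJ.
    by have -> : q.+1 = d0 + (q - d0).+1 by [lia]; rewrite hb; lia.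
  + by have -> : q.+1 = J + (q - J).+1 by [lia]; rewrite hR; lia.
- have h1 : height p 1 = P by rewrite hL ?subn0.
  have hQ : height p J.+1 = P by have := hR 0 isT; rewrite addn1 subn0.
  split; rewrite ?h1 ?hQ //.
  case=> [//|q] /= qJ; case: (cover q) => [|qP|[Pq qJ']|Jq]; first by lia.
  + by rewrite hL //; lia.
  + have [d0 [e [[? ?] dq [? ?] _ [hb _]]]] := block q Pq qJ'.
    by have -> : q.+1 = d0 + (q - d0).+1 by [lia]; rewrite hb; lia.
  + by have -> : q = J by [lia]; rewrite hQ; lia.
move=> d; have dn := ltn_ord d.
have h1 : height p 1 = P by rewrite hL ?subn0.
have hQ : height p J.+1 = P by have := hR 0 isT; rewrite addn1 subn0.
case: (cover d (ltnW dn)) => [dP|[Pd dJ]|Jd].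
- exists 1 => //; rewrite eqxx /=; case: (posnP d) => [d0|d_gt0].
    have := @pending_delete_jump n p d 0; rewrite addn0 d0 => /(_ _ _)/leq_ltn_trans; apply; try lia.
    by rewrite height0; lia.
  by rewrite -[X in _ < X]h1; apply: pending_delete_lt; apply: pending_of_lehmer; rewrite // lL ?h1; lia.
- have [d0 [e [[? ?] dd [? ?] hd0 [hb lb]]]] := block d Pd dJ.
  have old (i : 'I_n) : d0 < i <= d0 + e -> i \in pending p setT d0.
    by move=> id; apply: pending_of_lehmer; [lia | have := lb i id; rewrite hd0; lia].
  case: (eqVneq (nat_of_ord d) d0) => [dE|dNE].
    exists (d0 + e).+1; first by lia.
    rewrite ifF; last by lia.
    rewrite -dE in old *; have := @pending_delete_jump n p d e _ old.
    by rewrite dE hd0 => /(_ _)/leq_ltn_trans; apply; lia.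
  exists d0; first by lia.
  rewrite ifF; last by lia.
  by rewrite -[X in _ < X]hd0; apply: pending_delete_lt; apply: old; lia.
- exists J.+1; first by lia.
  rewrite eqxx orbT; case: (eqVneq (nat_of_ord d) J) => [dJ|dNJ].
    have := @pending_delete_jump n p d 0; rewrite addn0 dJ hJ => /(_ _ _)/leq_ltn_trans; apply; lia.
  rewrite -[X in _ < X]hQ; apply: pending_delete_lt; apply: pending_of_lehmer; first by lia.
  by rewrite lR ?hQ; lia.
Qed.

End Plateaus.

(** * Large sets of minimal non-members *)

Lemma contained_size k n (s : 'S_k) (p : 'S_n) : contained s p -> k <= n.
Proof.
move=> [f [fi _]]; rewrite -[k]card_ord -[n]card_ord; apply: (leq_card f).
exact: increasing_inj.
Qed.

Lemma contained_same_size n (s p : 'S_n) : contained s p -> s = p.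
Proof.
move=> [f [fi fs]].
have f_inj := increasing_inj fi.
have f_id i : f i = i.
  apply: val_inj => /=.
  rewrite -[LHS](card_ord_lt (ltnW (ltn_ord (f i)))) -[LHS](card_preimset _ f_inj).
  rewrite -[RHS](card_ord_lt (ltnW (ltn_ord i))).
  by apply: eq_card => j; rewrite !inE increasing_mono.
apply/permP => i; apply: val_inj => /=.
rewrite -[LHS](card_perm_lt s (ltnW (ltn_ord (s i)))).
rewrite -[RHS](card_perm_lt p (ltnW (ltn_ord (p i)))).
by apply: eq_card => j; rewrite !inE fs !f_id.
Qed.

(** Each of the blocks [[:: F + 1; c]] has two letters, so the block of three
    letters is used to reach lengths of the other parity. *)
Definition plateau_blocks (F : nat) (o : bool) (t : seq nat) : seq (seq nat) :=
  (if o then [:: [:: F + 2; 0; 0]] else [::]) ++ [seq [:: F + 1; c] | c <- t].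

(** The two anchors have [F + 8] letters when [P = F + 3], the least value of [P]
    that keeps the height [F + 2] reached in the block of three letters below
    [P]. *)
Definition plateau_perms (F n : nat) : {set 'S_n} :=
  let m := n - (F + 8) in
  [set p : 'S_n | [exists t : (m - 3 * odd m)./2.-tuple 'I_F.-1,
    code p == plateau_word F (F + 3) (plateau_blocks F (odd m) (map val t))]].

Lemma all_plateau_blocks F o (t : seq 'I_F.-1) : 2 < F ->
  all (is_block F (F + 3)) (plateau_blocks F o (map val t)).
Proof.
move=> F2; rewrite all_cat; apply/andP; split; first by case: o => //=; lia.
by apply/allP => _ /mapP[_ /mapP[c _ ->] ->] /=; have := ltn_ord c; lia.
Qed.

Lemma plateau_perms_minimal F n (p : 'S_n) : 2 < F -> p \in plateau_perms F n ->
  minimal_plateau F (F + 3) p.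
Proof.
move=> F2; rewrite inE => /existsP[t /eqP pt].
by apply: plateau_word_minimal pt; rewrite ?all_plateau_blocks //; lia.
Qed.

Lemma size_plateau_blocks F o t :
  size (flatten (plateau_blocks F o t)) = 3 * o + (size t).*2.
Proof.
rewrite flatten_cat size_cat; congr (_ + _); first by case: o.
by elim: t => //= c t ->; rewrite doubleS.
Qed.

(** Of the [n] letters, [F + 8] belong to the anchors and at most three to the
    block fixing the parity; every second one of the others is free. Squaring
    avoids halving the exponent. *)
Lemma card_plateau_perms F n : 2 < F -> F + 11 <= n ->
  F.-1 ^ (n - (F + 11)) <= #|plateau_perms F n| ^ 2.
Proof.
move=> F2 Fn; rewrite /plateau_perms; set m := n - (F + 8); set T := (m - 3 * odd m)./2.
have m3 : 3 <= m by lia.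
have mT : m = 3 * odd m + T.*2.
  have le3 : 3 * odd m <= m by case: (odd m); lia.
  by rewrite /T even_halfK ?subnKC // oddB // oddM oddb addbb.
pose word (t : T.-tuple 'I_F.-1) :=
  plateau_word F (F + 3) (plateau_blocks F (odd m) (map val t)).
have ex t : exists p : 'S_n, code p == word t.
  suff [p pt] : exists p : 'S_n, code p = word t by exists p; apply/eqP.
  apply: code_exists.
    rewrite /word /plateau_word !size_cat /= !size_nseq size_plateau_blocks.
    by rewrite size_map size_tuple; lia.
  rewrite /word /plateau_word !run_cat.
  have -> : run 0 (F + 3 :: nseq (F + 3 - F) 0) = F.
    by rewrite /= /step ltn0 -/(run _ _) run_zeros; lia.
  rewrite (@run_blocks F (F + 3)) ?all_plateau_blocks //=.
  by rewrite /step ltnNge leq_addr /= -/(run _ _) run_zeros ?subnn.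
pose g t := xchoose (ex t).
have gP t : code (g t) = word t by apply/eqP/(xchooseP (ex t)).
have word_inj : injective word.
  move=> t u tu; apply/val_inj/(inj_map val_inj).
  have eq_size : size (map val t) = size (map val u) by rewrite !size_map !size_tuple.
  move: tu => /eqP; rewrite /word /plateau_word eqseq_cat // eqxx /=.
  rewrite eqseq_cat ?size_plateau_blocks ?eq_size // => /andP[+ _].
  rewrite /plateau_blocks !flatten_cat eqseq_cat // eqxx /=.
  elim: (map val t) (map val u) eq_size => [|c t' IHt] [|c' u'] //= [/IHt tu].
  by rewrite !eqseq_cons eqxx /= => /andP[/eqP -> /tu ->].
have g_inj : injective g by move=> t u tu; apply: word_inj; rewrite -!gP tu.
have -> : F.-1 ^ (n - (F + 11)) = F.-1 ^ (m - 3) by congr (_ ^ _); lia.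
apply: (@leq_trans ((F.-1 ^ T) ^ 2)).
  by rewrite -expnM leq_pexp2l; lia.
rewrite leq_exp2r // -{1}[F.-1]card_ord -card_tuple -[X in X <= _]cardsT -(card_imset _ g_inj).
apply/subset_leq_card/subsetP => _ /imsetP[t _ ->].
by rewrite inE; apply/existsP; exists t; rewrite gP.
Qed.

(** For [F.-1 = (2 * K) ^ 2] each free letter contributes [2 * K] per letter of
    the word, and the spare powers of [2] absorb the bounded number of other
    letters. *)
Lemma large_antichain K : 0 < K ->
  exists F n0, 2 < F /\ forall n, n0 <= n -> 2 * K ^ n <= #|plateau_perms F n|.
Proof.
move=> K0; exists ((2 * K) ^ 2).+1; set F := ((2 * K) ^ 2).+1; pose r := F + 11.
have F2 : 2 < F by rewrite /F; nia.
exists (r + (K ^ r).+1); split=> // n rn.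
have Fn : F + 11 <= n by rewrite -/r; lia.
rewrite -(@leq_exp2r _ _ 2) //; apply: leq_trans (card_plateau_perms F2 Fn).
rewrite -/r /F /= -expnM [2 * (n - r)]mulnC expnM leq_exp2r //.
have -> : K ^ n = K ^ (n - r) * K ^ r by rewrite -expnD subnK //; lia.
rewrite expnMn mulnCA mulnC leq_mul2r; apply/orP; right.
apply: (@leq_trans (2 ^ (K ^ r).+1)); last by rewrite leq_exp2l //; lia.
by rewrite expnS leq_mul2l /= ltnW // ltn_expl.
Qed.

(** * Assembling the class *)

Lemma sum_option (V : nmodType) (T : finType) (g : option T -> V) :
  (\sum_t g t = g None + \sum_t g (Some t))%R.
Proof.
have enumE : enum {: option T} = None :: map some (enum T).
  by rewrite !enumT [in LHS]unlock.
by rewrite -big_enum enumE big_cons big_map big_enum.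
Qed.

(** The states are those of the automaton, plus the state [None] for the powers
    of [K]. *)
Lemma plateau_free_gf_rational F P K n0 (a : nat -> rat) : F < P ->
  (forall n, n0 <= n -> a n = (#|plateau_free F P n| + K ^ n)%:R%R) ->
  rational_series a.
Proof.
move=> FP aE.
pose S : finType := option ('I_P.+1 * bool).
pose ok (s : 'I_P.+1 * bool) := (s.1 <= P) && ~~ (s.2 && (s.1 == P :> nat)).
pose next (s : 'I_P.+1 * bool) := (s.1 == P :> nat) || s.2 && (F <= s.1).
pose M (s t : S) : rat := (match s, t with
  | None, None => K
  | Some s, Some t => ok s * \sum_(c < P.+1) ((step s.1 c == t.1 :> nat) && (next s == t.2))
  | _, _ => 0
  end)%:R%R.
pose N n (h : nat) (f : bool) := #|[set p : 'S_n | accept F P h f (code p)]|.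
pose v n (s : S) : rat := (if s is Some s then N n s.1 s.2 else K ^ n)%:R%R.
pose u (s : S) : rat := ((s == None) || (s == Some (ord0, false)))%:R%R.
apply: (@rational_of_transfer_matrix _ S M v u a n0) => [n s|n n0n].
  rewrite sum_option /v /M; case: s => [s|]; last first.
    by rewrite big1 ?addr0 => [|t _]; rewrite ?mul0r // -natrM expnS.
  rewrite mul0r add0r /N card_accept_letters -/(ok s) -/(next s).
  under [RHS]eq_bigr => t _ do rewrite -natrM.
  rewrite -natr_sum; congr (_%:R)%R.
  under [RHS]eq_bigr => t _ do rewrite -mulnA big_distrl /=.
  rewrite -big_distrr /= exchange_big /=; congr (_ * _); apply: eq_bigr => c _.
  case: (leqP (step s.1 c) P) => [cP|Pc].
    have cP' : step s.1 c < P.+1 by [].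
    rewrite (bigD1 (Ordinal cP', next s)) //= !eqxx mul1n big1 ?addn0 // => -[t1 t2].
    rewrite xpair_eqE -val_eqE /= => tNE.
    by rewrite [_ == t1 :> nat]eq_sym [_ == t2]eq_sym (negbTE tNE).
  rewrite big1 => [|t _]; last by case: eqP (ltn_ord t.1) => //= <-; rewrite ltnNge Pc.
  by apply: eq_card0 => p; rewrite inE; apply/negP => /accept_le; rewrite leqNgt Pc.
have u0 : u None = 1%R by [].
have u1 : u (Some (ord0, false)) = 1%R by rewrite /u eqxx orbT.
rewrite aE // [RHS]sum_option u0 mul1r (bigD1 (ord0, false)) //= u1 mul1r.
rewrite big1 ?addr0 => [|t /negbTE tNE]; last first.
  have St : (Some t == Some (ord0, false)) = false by apply: contraFF tNE => /eqP[->].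
  by rewrite /u St mul0r.
by rewrite natrD addrC.
Qed.

Definition first_elements (T : finType) (m : nat) (A : {set T}) : {set T} :=
  [set x in take m (enum A)].

Lemma first_elements_sub (T : finType) m (A : {set T}) : first_elements m A \subset A.
Proof. by apply/subsetP => x; rewrite inE => /mem_take; rewrite mem_enum. Qed.

Lemma card_first_elements (T : finType) m (A : {set T}) : m <= #|A| ->
  #|first_elements m A| = m.
Proof.
move=> mA; rewrite cardsE; have /card_uniqP -> : uniq (take m (enum A)) by rewrite take_uniq ?enum_uniq.
by rewrite size_takel // -cardE.
Qed.

Theorem theorem3p2 (C : permset) (hC : perm_class C)
    (hproper : proper_permset C) :
  exists D : permset,
    perm_class D /\ permset_sub C D /\ rational_series (class_gf D).
Proof.
have [k [s sC]] := hproper.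
have [K K0 CK] := stanley_wilf hC sC.
have [F [n0 [F2 large]]] := large_antichain K0.
pose P := F + 3; have FP : F < P by rewrite /P; lia.
pose X := plateau_free F P.
pose A := plateau_perms F.
pose S n := if n0 < n then first_elements (K ^ n - #|C n :\: X n|) (A n :\: C n) else set0.
have SA n p : p \in S n -> p \in A n :\: C n.
  by rewrite /S; case: ifP => _; [apply: (subsetP (first_elements_sub _ _)) | rewrite in_set0].
exists (fun n => (X n :|: C n) :|: S n); split; [|split].
- move=> m n t p; rewrite !in_setU -orbA => /or3P[pX|pC|pS] tp.
  + by rewrite (plateau_free_class FP pX tp).
  + by rewrite (hC _ _ _ _ pC tp) orbT.
  + have /setDP[/(plateau_perms_minimal F2) pA _] := SA _ _ pS.
    case: (ltngtP m n) (contained_size tp) => [mn _|//|mn _].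
      by rewrite (minimal_plateau_proper FP pA tp mn).
    by subst m; rewrite (contained_same_size tp) pS !orbT.
- by move=> n; rewrite -setUA setUCA subsetUl.
apply: (@plateau_free_gf_rational F P K n0.+1) => // n n0n.
rewrite /class_gf ifF; last by lia.
congr (_%:R)%R.
have XCS0 : (X n :|: C n) :&: S n = set0.
  apply/setP => p; rewrite in_set0; apply/negP => /setIP[+ /SA/setDP[]].
  move=> pXC /(plateau_perms_minimal F2)/(minimal_plateau_notin FP) pX pC.
  by move: pXC; rewrite in_setU (negbTE pC) (negbTE pX).
have cardXC : #|X n :|: C n| = #|X n| + #|C n :\: X n|.
  by rewrite cardsU cardsD addnBA ?subset_leq_card ?subsetIl // [C n :&: _]setIC.
have leC : #|C n :\: X n| <= K ^ n.
  by apply: leq_trans (CK n _); rewrite ?subset_leq_card ?subsetDl //; lia.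
have cardS : #|S n| = K ^ n - #|C n :\: X n|.
  rewrite /S n0n card_first_elements // [#|A n :\: C n|]cardsD.
  have := large n (ltnW n0n); have := CK n (leq_ltn_trans (leq0n _) n0n).
  by have := subset_leq_card (subsetIr (A n) (C n)); rewrite -/(A n); lia.
rewrite cardsU XCS0 cards0 subn0 cardXC cardS -addnA subnKC //.
Qed.
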